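(* Let $G_1\,{}_\alpha\diamond_\beta\,G_2$ be the doubly warped product of two weighted graphs with warping functions $\alpha:G_2\to(0,\infty)$, $\beta:G_1\to(0,\infty)$, let $x\in G_1$, $p\in G_2$, $\mathcal N\in(0,\infty]$ and $K_1,K_2\in\mathbb R$. If $$\alpha^2\Delta^{G_2}\alpha^{-2}\le-2\alpha^{-2}\beta^2K_1\qquad\text{and}\qquad\beta^2\Delta^{G_1}\beta^{-2}\le-2\beta^{-2}\alpha^2K_2,$$ then $$\mathcal K_{(x,p)}(\mathcal N)\le\min\Big\{\frac{\mathcal K_{G_1,x}(\mathcal N)-K_1}{\alpha^2},\ \frac{\mathcal K_{G_2,p}(\mathcal N)-K_2}{\beta^2}\Big\}.$$
   Context: A weighted graph $(G,\omega,m)$ consists of a countable vertex set $G$, nonnegative edge weights $\omega_{xy}$, not necessarily symmetric but with $\omega_{xy}=s(x,y)\omega_{yx}$ for some $s(x,y)\neq0$, and a vertex measure $m:G\to(0,\infty)$. Write $x\sim y$ if $\omega_{xy}>0$; every vertex has at least one neighbour and only finitely many. For $f:G\to\mathbb R$, $\Delta f(x)=m(x)^{-1}\sum_{y\sim x}(f(y)-f(x))\omega_{xy}$; $\Gamma(u,v)=\frac12(\Delta(uv)-v\Delta u-u\Delta v)$, $\Gamma_2(u,v)=\frac12(\Delta\Gamma(u,v)-\Gamma(\Delta u,v)-\Gamma(u,\Delta v))$, $\Gamma(f)=\Gamma(f,f)$, $\Gamma_2(f)=\Gamma_2(f,f)$. A superscript $G_i$ indicates the graph in which the operator is taken. For $\mathcal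 N\in(0,\infty]$ ($\infty^{-1}=0$), $\mathcal K_{G,x}(\mathcal N)$ is the largest $\mathcal K$ with $\Gamma_2(f)(x)\ge\mathcal N^{-1}(\Delta f(x))^2+\mathcal K\,\Gamma(f)(x)$ for all $f:G\to\mathbb R$. The doubly warped product $G_1\,{}_\alpha\diamond_\beta\,G_2$ of $(G_1,\omega^{G_1},m^{G_1})$ and $(G_2,\omega^{G_2},m^{G_2})$ is the Cartesian product graph on $G_1\times G_2$ with vertex measure $m((x,p))=m^{G_1}(x)m^{G_2}(p)$ and edge weights $\omega_{((x,p),(y,q))}=\delta_{pq}\,m^{G_2}(p)\,\alpha^{-2}(p)\,\omega^{G_1}_{xy}+\delta_{xy}\,m^{G_1}(x)\,\beta^{-2}(x)\,\omega^{G_2}_{pq}$. $\mathcal K_{(x,p)}$ is its curvature function at $(x,p)$. In all formulas $\alpha=\alpha(p)$, $\beta=\beta(x)$, $\Delta^{G_2}\alpha^{-2}$ is evaluated at $p$ and $\Delta^{G_1}\beta^{-2}$ at $x$. *)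

(* Defs.v *)
From HB Require Import structures.
From mathcomp Require Import all_boot all_order all_algebra.
From mathcomp Require Import all_classical all_reals all_analysis.
Set Implicit Arguments.
Unset Strict Implicit.
Unset Printing Implicit Defensive.
Import Order.TTheory GRing.Theory Num.Theory.

Local Open Scope classical_set_scope.
Local Open Scope ring_scope.

(* Weights need not be symmetric: [weight_sym] only makes adjacency
   symmetric.  Loops are not excluded; they do not contribute to the
   Laplacian. *)
Record wgraph (R : realType) (V : countType) := WGraph {
  weight : V -> V -> R;
  vmeasure : V -> R;
  weight_ge0 : forall x y, 0 <= weight x y;
  weight_sym : exists s : V -> V -> R,
    (forall x y, s x y != 0) /\
    (forall x y, weight x y = s x y * weight y x);
  vmeasure_gt0 : forall x, 0 < vmeasure x;
  nbhd_neq0 : forall x, [set y | 0 < weight x y] !=set0;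
  nbhd_finite : forall x, finite_set [set y | 0 < weight x y]
}.

Section Curvature.
Variables (R : realType) (V : countType) (G : wgraph R V).
Implicit Types (u v f : V -> R) (x y : V) (N : \bar R) (K : R).

Definition nbhd x : set V := [set y | 0 < weight G x y].

Definition laplacian f : V -> R := fun x =>
  (vmeasure G x)^-1 * \sum_(y \in nbhd x) (f y - f x) * weight G x y.

Definition Gamma_bilin u v : V -> R := fun x =>
  2^-1 * (laplacian (fun y => u y * v y) x
          - v x * laplacian u x - u x * laplacian v x).

Definition Gamma2_bilin u v : V -> R := fun x =>
  2^-1 * (laplacian (Gamma_bilin u v) x
          - Gamma_bilin (laplacian u) v x - Gamma_bilin u (laplacian v) x).

Definition Gamma f := Gamma_bilin f f.
Definition Gamma2 f := Gamma2_bilin f f.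

(* For 0 < N the extended real N^-1 is finite, and it is 0 for N = +oo. *)
Definition curvature_dim N x K : Prop :=
  forall f, Gamma2 f x >= fine (N^-1)%E * laplacian f x ^+ 2 + K * Gamma f x.

(* The largest K satisfying [curvature_dim], see [curvature_largestP].  It is
   extended-real valued because every K is admissible at a vertex whose only
   neighbour is itself. *)
Definition curvature N x : \bar R :=
  ereal_sup [set K%:E | K in [set K | curvature_dim N x K]].

Lemma curvature_largestP N x K :
  curvature N x = K%:E <->
  curvature_dim N x K /\ (forall K', curvature_dim N x K' -> K' <= K).
Proof.
split=> [sK|[cK maxK]].
- have ubK K' : curvature_dim N x K' -> K' <= K.
    by move=> cK'; rewrite -lee_fin -sK; apply: ereal_sup_ubound; exists K'.
  split=> // f; apply/ler_addgt0Pr => e e0.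
  have g0 : 0 < `|Gamma f x| + 1 by rewrite ltr_wpDl.
  have d0 : 0 < e / (`|Gamma f x| + 1) by rewrite divr_gt0.
  have : ((K - e / (`|Gamma f x| + 1))%:E < curvature N x)%E.
    by rewrite sK lte_fin ltrBlDr ltrDl.
  case/ereal_sup_gt => _ [K' cK' <-]; rewrite lte_fin => ltK'.
  have leK' := ubK _ cK'.
  rewrite (_ : K = K' + (K - K')); last by rewrite addrC subrK.
  rewrite mulrDl addrA lerD ?cK' //.
  apply: (le_trans (ler_norm _)); rewrite normrM ger0_norm ?subr_ge0 //.
  have leKd : K - K' <= e / (`|Gamma f x| + 1).
    by rewrite lerBlDl -lerBlDr ltW.
  apply: (le_trans (ler_wpM2r (normr_ge0 _) leKd)).
  by rewrite mulrAC ler_pdivrMr // ler_wpM2l ?lerDl // ltW.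
- apply/eqP; rewrite eq_le; apply/andP; split.
  + by apply: ge_ereal_sup => _ [K' cK' <-]; rewrite lee_fin maxK.
  + by apply: ereal_sup_ubound; exists K.
Qed.

End Curvature.

Lemma weight_neq0C (R : realType) (V : countType) (G : wgraph R V) x y :
  weight G x y != 0 -> weight G y x != 0.
Proof.
have [s [_ sE]] := weight_sym G.
by apply: contraNneq => w0; rewrite sE w0 mulr0.
Qed.

Section WarpedProduct.
Variables (R : realType) (V1 V2 : countType).
Variables (G1 : wgraph R V1) (G2 : wgraph R V2).
Variables (alpha : V2 -> R) (beta : V1 -> R).
Hypothesis alpha_gt0 : forall p, 0 < alpha p.
Hypothesis beta_gt0 : forall x, 0 < beta x.

Definition warped_weight (a b : V1 * V2) : R :=
  (a.2 == b.2)%:R * vmeasure G2 a.2 * alpha a.2 ^- 2 * weight G1 a.1 b.1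
  + (a.1 == b.1)%:R * vmeasure G1 a.1 * beta a.1 ^- 2 * weight G2 a.2 b.2.

Definition warped_measure (a : V1 * V2) : R :=
  vmeasure G1 a.1 * vmeasure G2 a.2.

Let c1_gt0 p : 0 < vmeasure G2 p * alpha p ^- 2.
Proof. by rewrite mulr_gt0 ?vmeasure_gt0 // invr_gt0 exprn_gt0. Qed.

Let c2_gt0 x : 0 < vmeasure G1 x * beta x ^- 2.
Proof. by rewrite mulr_gt0 ?vmeasure_gt0 // invr_gt0 exprn_gt0. Qed.

Let term1_ge0 (a b : V1 * V2) :
  0 <= (a.2 == b.2)%:R * vmeasure G2 a.2 * alpha a.2 ^- 2 * weight G1 a.1 b.1.
Proof. by rewrite -(mulrA _%:R) mulr_ge0 ?weight_ge0 // mulr_ge0 // ltW. Qed.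

Let term2_ge0 (a b : V1 * V2) :
  0 <= (a.1 == b.1)%:R * vmeasure G1 a.1 * beta a.1 ^- 2 * weight G2 a.2 b.2.
Proof. by rewrite -(mulrA _%:R) mulr_ge0 ?weight_ge0 // mulr_ge0 // ltW. Qed.

Lemma warped_weight_ge0 a b : 0 <= warped_weight a b.
Proof. by rewrite addr_ge0. Qed.

Lemma warped_weight_neq0 a b : (warped_weight a b != 0) =
  (a.2 == b.2) && (weight G1 a.1 b.1 != 0)
  || (a.1 == b.1) && (weight G2 a.2 b.2 != 0).
Proof.
have c1 : vmeasure G2 a.2 * alpha a.2 ^- 2 != 0 by rewrite gt_eqF.
have c2 : vmeasure G1 a.1 * beta a.1 ^- 2 != 0 by rewrite gt_eqF.
have neq0E (t : bool) (c w : R) : c != 0 ->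
    (t%:R * (c * w) != 0) = t && (w != 0).
  by case: t => c0; rewrite ?mul0r ?eqxx // mul1r mulf_eq0 (negbTE c0).
by rewrite paddr_eq0 // negb_and -!(mulrA _%:R) !neq0E.
Qed.

Lemma warped_weight_sym : exists s : V1 * V2 -> V1 * V2 -> R,
  (forall a b, s a b != 0) /\
  (forall a b, warped_weight a b = s a b * warped_weight b a).
Proof.
have wC a b : warped_weight a b != 0 -> warped_weight b a != 0.
  rewrite !warped_weight_neq0 => /orP[] /andP[/eqP -> /weight_neq0C ->].
    by rewrite eqxx.
  by rewrite eqxx orbT.
exists (fun a b => if warped_weight b a == 0 then 1
                   else warped_weight a b / warped_weight b a).
split=> a b; case: (altP (warped_weight b a =P 0)) => [w0|w0].
- exact: oner_neq0.
- by rewrite mulf_neq0 ?invr_eq0 // wC.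
- rewrite w0 mulr0; apply/eqP; apply: contraTT isT => /wC.
  by rewrite w0 eqxx.
- by rewrite divfK.
Qed.

Lemma warped_measure_gt0 a : 0 < warped_measure a.
Proof. by rewrite mulr_gt0 ?vmeasure_gt0. Qed.

Lemma warped_nbhd_neq0 a : [set b | 0 < warped_weight a b] !=set0.
Proof.
have [y /= wy] := nbhd_neq0 G1 a.1.
exists (y, a.2) => /=; rewrite lt_def warped_weight_ge0 andbT.
by rewrite warped_weight_neq0 /= eqxx gt_eqF.
Qed.

Lemma warped_nbhd_finite a : finite_set [set b | 0 < warped_weight a b].
Proof.
apply: (@sub_finite_set _ _ ((nbhd G1 a.1 `|` [set a.1])
                          `*` (nbhd G2 a.2 `|` [set a.2]))); last first.
  by apply: finite_setX; rewrite finite_setU; split;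
    [exact: nbhd_finite | exact: finite_set1
    |exact: nbhd_finite | exact: finite_set1].
move=> [y q] /=; rewrite lt_def warped_weight_neq0 /= /nbhd /=.
by move=> /andP[/orP[] /andP[/eqP <- w0] _]; split; auto;
  left => /=; rewrite lt_def w0 weight_ge0.
Qed.

Definition warped_product : wgraph R (V1 * V2)%type :=
  WGraph warped_weight_ge0 warped_weight_sym warped_measure_gt0
         warped_nbhd_neq0 warped_nbhd_finite.

End WarpedProduct.

(* Main.v *)
(* Test the curvature inequality of the product on the pullback F of a function
   f on one factor, say G1.  The second part of the Laplacian only sees the
   warping function, so that at (x, p)
     Delta F = alpha^-2 Delta f,   Gamma F = alpha^-2 Gamma f,
     Gamma_2 F = alpha^-4 Gamma_2 f
                 + (1/2) beta^-2 (Delta^{G2} alpha^-2) Gamma f.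
   The hypothesis bounds the last term by - alpha^-4 K1 Gamma f, hence K
   admissible for the product makes alpha^2 K + K1 admissible for G1. *)
Require Import Defs.
From mathcomp Require Import all_boot all_order all_algebra.
From mathcomp Require Import all_classical all_reals all_analysis.
From mathcomp Require Import ring.
Import Order.TTheory GRing.Theory Num.Theory.
Local Open Scope ring_scope.

Set Implicit Arguments.
Unset Strict Implicit.
Unset Printing Implicit Defensive.

(** * Calculus of the Laplacian and of [Gamma] on a single graph *)

Section Laplacian.
Context {R : realType} {V : countType} (G : wgraph R V).
Implicit Types (u v f : V -> R) (x y : V) (N : \bar R) (K : R).

Lemma notin_nbhd_weight x y : ~ nbhd G x y -> weight G x y = 0.
Proof.
move=> /negP wy; apply/eqP; move: wy.
by rewrite lt_def weight_ge0 andbT negbK.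
Qed.

(** Weights vanish off the neighbourhood, so sums over different neighbourhoods can be moved to one
    common index set. *)
Lemma fsbig_nbhd_weight (D : set V) (g : V -> R) x :
  (nbhd G x `<=` D)%classic ->
  \sum_(y \in nbhd G x) g y * weight G x y = \sum_(y \in D) g y * weight G x y.
Proof.
move=> sD; apply: fsbig_widen => // y [_ /= yx].
by rewrite /= notin_nbhd_weight ?mulr0.
Qed.

Lemma laplacianZl c f x : laplacian G (fun y => c * f y) x = c * laplacian G f x.
Proof.
rewrite /laplacian [RHS]mulrCA !fsbig_finite; try exact: nbhd_finite.
congr (_ * _); rewrite mulr_sumr; apply: eq_bigr => y _; ring.
Qed.

Lemma laplacianZr c f x : laplacian G (fun y => f y * c) x = laplacian G f x * c.
Proof.
by rewrite mulrC -laplacianZl; congr (laplacian G _ x); apply/funext => y;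
  rewrite mulrC.
Qed.

Lemma laplacian_cst c x : laplacian G (fun=> c) x = 0.
Proof. by rewrite /laplacian fsbig1 ?mulr0 // => y _; rewrite subrr mul0r. Qed.

Lemma Gamma_bilinC u v x : Gamma_bilin G u v x = Gamma_bilin G v u x.
Proof.
rewrite /Gamma_bilin addrAC; congr (_ * (laplacian G _ x - _ - _)).
by apply/funext => y; rewrite mulrC.
Qed.

(** Termwise, $f(y)^2 - f(x)^2 - 2f(x)(f(y)-f(x)) = (f(y)-f(x))^2$; this makes the sign of [Gamma]
    visible. *)
Lemma GammaE f x : Gamma G f x =
  2^-1 * ((vmeasure G x)^-1 *
          \sum_(y \in nbhd G x) (f y - f x) ^+ 2 * weight G x y).
Proof.
rewrite /Gamma /Gamma_bilin /laplacian; congr (_ * _).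
rewrite !(mulrCA (f x)) -!mulrBr; congr (_ * _).
rewrite !fsbig_finite; try exact: nbhd_finite.
rewrite mulr_sumr -!sumrB; apply: eq_bigr => y _; ring.
Qed.

Lemma Gamma_ge0 f x : 0 <= Gamma G f x.
Proof.
rewrite GammaE !mulr_ge0 ?invr_ge0 ?ler0n ?(ltW (vmeasure_gt0 G x)) //.
rewrite fsbig_finite; last exact: nbhd_finite.
by apply: sumr_ge0 => y _; rewrite mulr_ge0 ?sqr_ge0 ?weight_ge0.
Qed.

Lemma curvature_dim_le N x K K' :
  K' <= K -> curvature_dim G N x K -> curvature_dim G N x K'.
Proof.
move=> leK cK f; apply: le_trans (cK f).
by rewrite lerD2l ler_wpM2r ?Gamma_ge0.
Qed.

End Laplacian.

(* [e] is the identity or the swap of the two factors, so that both bounds of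
   the minimum come from the same statement; [a] and [b] stand for [alpha^-2]
   and [beta^-2]. *)
Section Fiber.
Context {R : realType} {V1 V2 W : countType}.
Variables (G1 : wgraph R V1) (G2 : wgraph R V2) (G : wgraph R W).
Variables (e : V1 -> V2 -> W) (pr : W -> V1) (a : V2 -> R) (b : V1 -> R).
Hypothesis prK : forall y q, pr (e y q) = y.
Hypothesis laplacian_e : forall F y q, laplacian G F (e y q) =
  a q * laplacian G1 (fun z => F (e z q)) y
  + b y * laplacian G2 (fun r => F (e y r)) q.
Implicit Types (u v f : V1 -> R) (F H : W -> R).

Lemma laplacian_fiber F u y q : (forall z r, F (e z r) = u z) ->
  laplacian G F (e y q) = a q * laplacian G1 u y.
Proof.
move=> FE; rewrite laplacian_e.
have -> : (fun z => F (e z q)) = u by apply/funext => z; rewrite FE.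
have -> : (fun r => F (e y r)) = (fun=> u y) by apply/funext => r; rewrite FE.
by rewrite laplacian_cst mulr0 addr0.
Qed.

(** Both the Laplacian and [Gamma] of a pullback have this product form with [c = a], which is how
    the Laplacian of the warping function enters [Gamma2]. *)
Lemma laplacian_fiberM F u (c : V2 -> R) y q :
  (forall z r, F (e z r) = c r * u z) ->
  laplacian G F (e y q) =
    a q * (c q * laplacian G1 u y) + b y * (laplacian G2 c q * u y).
Proof.
move=> FE; rewrite laplacian_e.
have -> : (fun z => F (e z q)) = (fun z => c q * u z).
  by apply/funext => z; rewrite FE.
have -> : (fun r => F (e y r)) = (fun r => c r * u y).
  by apply/funext => r; rewrite FE.
by rewrite laplacianZl laplacianZr.
Qed.

(** No [b] term survives: the one in the Laplacian of [F * H] cancels against the one in [H] times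
    the Laplacian of [F], and [H], a pullback, has none. *)
Lemma Gamma_fiber F H u v (c : V2 -> R) y q :
  (forall z r, F (e z r) = c r * u z) -> (forall z r, H (e z r) = v z) ->
  Gamma_bilin G F H (e y q) = a q * (c q * Gamma_bilin G1 u v y).
Proof.
move=> FE HE; rewrite /Gamma_bilin.
rewrite (@laplacian_fiberM (fun w => F w * H w) (fun z => u z * v z) c);
  last by move=> z r; rewrite FE HE mulrA.
rewrite (@laplacian_fiberM F u c) // (@laplacian_fiber H v) // FE HE; ring.
Qed.

Lemma Gamma_fiber_fiber F u y q : (forall z r, F (e z r) = u z) ->
  Gamma G F (e y q) = a q * Gamma G1 u y.
Proof.
move=> FE; rewrite /Gamma (@Gamma_fiber F F u u (fun=> 1)) ?mul1r // => z r.
by rewrite FE mul1r.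
Qed.

Lemma Gamma2_fiber F u y q : (forall z r, F (e z r) = u z) ->
  Gamma2 G F (e y q) = a q ^+ 2 * Gamma2 G1 u y
    + 2^-1 * b y * laplacian G2 a q * Gamma G1 u y.
Proof.
move=> FE.
(* [Gamma_fiber] allows the coefficient [c] only in its first argument, so the Laplacian is moved
   there. *)
rewrite /Gamma2 /Gamma2_bilin (Gamma_bilinC G F) (Gamma_bilinC G1 u).
rewrite (@Gamma_fiber (laplacian G F) F (laplacian G1 u) u a) //; last first.
  by move=> z r; exact: laplacian_fiber.
rewrite (@laplacian_fiberM _ (Gamma G1 u) a); last first.
  by move=> z r; exact: Gamma_fiber_fiber.
rewrite /Gamma; ring.
Qed.

(** [Gamma2] and the squared Laplacian both scale by [a p ^+ 2], so dividing by it leaves [N]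
    unchanged, while [Gamma] scales only by [a p]. *)
Lemma curvature_dim_fiber N x p K : 0 < a p ->
  curvature_dim G N (e x p) K ->
  curvature_dim G1 N x (K / a p - 2^-1 * b x * laplacian G2 a p / a p ^+ 2).
Proof.
move=> a0 cK f.
have fE z r : (f \o pr) (e z r) = f z by rewrite /= prK.
have := cK (f \o pr).
rewrite (Gamma2_fiber _ _ fE) (Gamma_fiber_fiber _ _ fE) (laplacian_fiber _ _ fE).
rewrite -lerBlDr => cKf; rewrite -(@ler_pM2l _ (a p ^+ 2)) ?exprn_gt0 //.
apply: le_trans cKf; rewrite le_eqVlt; apply/orP; left; apply/eqP.
by field; rewrite gt_eqF.
Qed.

Lemma curvature_fiber_le N x p k (s t : R) : 0 < s -> a p = s ^- 2 ->
  0 < t -> b x = t ^- 2 ->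
  s ^+ 2 * laplacian G2 a p <= - 2 * s ^- 2 * t ^+ 2 * k ->
  (curvature G N (e x p) <= (curvature G1 N x - k%:E) / (s ^+ 2)%:E)%E.
Proof.
move=> s0 aE t0 bE hk; apply: ge_ereal_sup => _ [K cK <-].
have s20 : 0 < s ^+ 2 by rewrite exprn_gt0.
have a0 : 0 < a p by rewrite aE invr_gt0.
(* Only finite quantities are moved across, so an infinite curvature of [G1] needs no separate
   case. *)
rewrite inver gt_eqF // lee_pdivlMr // leeBrDr //; apply: ereal_sup_ubound => /=.
exists (K * s ^+ 2 + k) => //.
apply: curvature_dim_le (curvature_dim_fiber a0 cK).
rewrite bE aE invrK lerD2l -subr_ge0.
(* The slack is a positive multiple of the gap between the two sides of [hk]. *)
rewrite (_ : _ - k = 2^-1 * s ^+ 2 * t ^- 2 *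
  (- 2 * s ^- 2 * t ^+ 2 * k - s ^+ 2 * laplacian G2 a p)).
  by rewrite !mulr_ge0 ?subr_ge0 ?invr_ge0 ?exprn_ge0 // ltW.
by field; rewrite !gt_eqF.
Qed.

End Fiber.

(** * The Laplacian of the warped product and the two curvature bounds *)

Section Warped.
Context {R : realType} {V1 V2 : countType}.
Variables (G1 : wgraph R V1) (G2 : wgraph R V2).
Variables (alpha : V2 -> R) (beta : V1 -> R).
Hypothesis alpha_gt0 : forall q, 0 < alpha q.
Hypothesis beta_gt0 : forall y, 0 < beta y.

Lemma laplacian_warped (F : V1 * V2 -> R) y q :
  laplacian (warped_product G1 G2 alpha_gt0 beta_gt0) F (y, q) =
  alpha q ^- 2 * laplacian G1 (fun z => F (z, q)) y
  + beta y ^- 2 * laplacian G2 (fun r => F (y, r)) q.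
Proof.
set G := warped_product _ _ _ _.
(* A finite set large enough to split the product weight into its two halves and then shrink each
   half to its own fibre. *)
pose D := ((nbhd G (y, q) `|` (pair^~ q) @` nbhd G1 y)
  `|` (pair y) @` nbhd G2 q)%classic.
have Dfin : finite_set D.
  rewrite !finite_setU; split; [split|]; [|apply: finite_image ..];
    exact: nbhd_finite.
rewrite /laplacian (@fsbig_nbhd_weight _ _ _ D); last by move=> ? ?; left; left.
rewrite {2}/weight /= /warped_weight /=.
under eq_fsbigr do rewrite mulrDr.
rewrite fsbig_split //=.
have -> : \sum_(i \in D) (F i - F (y, q)) *
    ((q == i.2)%:R * vmeasure G2 q * alpha q ^- 2 * weight G1 y i.1) =
  vmeasure G2 q * alpha q ^- 2 *
    \sum_(z \in nbhd G1 y) (F (z, q) - F (y, q)) * weight G1 y z.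
  rewrite -(@fsbig_widen _ _ _ _ (pair^~ q @` nbhd G1 y)%classic).
  - rewrite fsbig_image; last by move=> z t _ _ [].
    rewrite !fsbig_finite; try exact: nbhd_finite.
    by rewrite mulr_sumr; apply: eq_bigr => z _; rewrite /= eqxx mul1r mulrCA.
  - by move=> ? ?; left; right.
  (* Off this fibre neighbourhood either the Kronecker factor or the [G1] weight is zero. *)
  - move=> [z r] [_ /= nzr]; case: eqP => [qr|_]; last by rewrite !mul0r mulr0.
    rewrite notin_nbhd_weight ?mulr0 // => nz; apply: nzr; exists z => //.
    by rewrite qr.
have -> : \sum_(i \in D) (F i - F (y, q)) *
    ((y == i.1)%:R * vmeasure G1 y * beta y ^- 2 * weight G2 q i.2) =
  vmeasure G1 y * beta y ^- 2 *
    \sum_(r \in nbhd G2 q) (F (y, r) - F (y, q)) * weight G2 q r.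
  rewrite -(@fsbig_widen _ _ _ _ (pair y @` nbhd G2 q)%classic).
  - rewrite fsbig_image; last by move=> z t _ _ [].
    rewrite !fsbig_finite; try exact: nbhd_finite.
    by rewrite mulr_sumr; apply: eq_bigr => z _; rewrite /= eqxx mul1r mulrCA.
  - by move=> ? ?; right.
  - move=> [z r] [_ /= nzr]; case: eqP => [yz|_]; last by rewrite !mul0r mulr0.
    rewrite notin_nbhd_weight ?mulr0 // => nr; apply: nzr; exists r => //.
    by rewrite yz.
(* In each half the measure of the other factor cancels against the product measure. *)
rewrite /warped_measure /=; field.
by rewrite !gt_eqF ?vmeasure_gt0.
Qed.

End Warped.

Theorem corollary1p21 (R : realType) (V1 V2 : countType)
    (G1 : wgraph R V1) (G2 : wgraph R V2)
    (alpha : V2 -> R) (beta : V1 -> R)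
    (alpha_gt0 : forall q, 0 < alpha q) (beta_gt0 : forall y, 0 < beta y)
    (x : V1) (p : V2) (N : \bar R) (N_gt0 : (0 < N)%E) (K1 K2 : R) :
  alpha p ^+ 2 * laplacian G2 (fun q => alpha q ^- 2) p
    <= - 2 * alpha p ^- 2 * beta x ^+ 2 * K1 ->
  beta x ^+ 2 * laplacian G1 (fun y => beta y ^- 2) x
    <= - 2 * beta x ^- 2 * alpha p ^+ 2 * K2 ->
  (curvature (warped_product G1 G2 alpha_gt0 beta_gt0) N (x, p)
    <= Order.min ((curvature G1 N x - K1%:E) / (alpha p ^+ 2)%:E)
                 ((curvature G2 N p - K2%:E) / (beta x ^+ 2)%:E))%E.
Proof.
move=> h1 h2; rewrite le_min; apply/andP; split.
- apply: (@curvature_fiber_le _ _ _ _ G1 G2 _ pair fst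
    (fun q => alpha q ^- 2) (fun y => beta y ^- 2)) h1 => //.
  exact: laplacian_warped.
- apply: (@curvature_fiber_le _ _ _ _ G2 G1 _ (fun q y => (y, q)) snd
    (fun y => beta y ^- 2) (fun q => alpha q ^- 2)) h2 => //.
  by move=> F q y; rewrite laplacian_warped addrC.
Qed.
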